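(* Let $\ell\geq 1$ be a natural number. Let $X$ be a Hilbert space, $C$ a nonempty closed convex bounded subset of $X$, $b\in\mathbb{N}$, $b\geq1$, an upper bound on the diameter of $C$, and $T_0,\ldots,T_{\ell-1}$ nonexpansive selfmappings of $C$. For each $n\in\mathbb{N}$ let $U_n:=T_{n \bmod \ell}$ and assume that $\tau:\mathbb{N}\to\mathbb{N}$ is a monotone function satisfying $$\forall k\in\mathbb{N}\ \forall m\in\mathbb{N}\ \forall x\in C\left(\|x-U_{m+\ell}\cdots U_{m+1}(x)\|\leq\frac{1}{\tau(k)+1}\rightarrow\forall i<\ell\left(\|x-U_i(x)\|<\frac{1}{k+1}\right)\right).$$ Consider a sequence $(\lambda_n)_{n\in\mathbb{N}}$ in $(0,1)$ and monotone functions $\mu,\nu,\xi:\mathbb{N}\to\mathbb{N}$ such that - $\forall k\in\mathbb{N}\ \forall n\geq\mu(k)\left(\lambda_n\leq\frac{1}{k+1}\right)$; - $\forall k\in\mathbb{N}\left(\sum_{j=0}^{\nu(k)}\lambda_j\geq k\right)$; - $\forall k\in\mathbb{N}\ \forall n\geq 1\left(\sum_{j=\xi(k)+1}^{\xi(k)+n}|\lambda_j-\lambda_{j+\ell}|\leq\frac{1}{k+1}\right)$. Let $u_0\in C$ and define $u_{n+1}:=\lambda_{n+1}u_0+(1-\lambda_{n+1})U_{n+1}(u_n)$ for $n\in\mathbb{N}$. Then, for all $k\in\mathbb{N}$ and every monotone function $f:\mathbb{N}\to\mathbb{N}$, $$\exists N\leq\phi_b(k,f)\ \forall i,j\in[N,f(N)]\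 \left(\|u_i-u_j\|\leq\frac{1}{k+1}\right),$$ where $$\phi_b(k,f):=\sigma'\left(2k+1,\ \psi\left(48(k+1)^2-1,\ \overline{f}\right)\right),\qquad \overline{f}(m):=36b(k+1)^2\left(f(\sigma'(2k+1,m))+1\right)-1,$$ and $\sigma'$, $\psi$ are the functions defined in the context.
   Context: $\mathbb{N}=\{0,1,2,\ldots\}$. For $n,m\in\mathbb{N}$, $[n,m]:=\{n,n+1,\ldots,m\}$ (empty if $m<n$). A map $T$ is nonexpansive if $\|T(x)-T(y)\|\leq\|x-y\|$ for all $x,y$. A function $f:\mathbb{N}\to\mathbb{N}$ is monotone if $k\leq n$ implies $f(k)\leq f(n)$. For $g:\mathbb{N}\to\mathbb{N}$, $g^{(n)}$ is the $n$-fold composition of $g$ with itself. Products such as $U_{m+\ell}\cdots U_{m+1}$ denote composition of maps. Definitions (depending on $b,\ell,\mu,\nu,\xi,\tau$): - $r(k):=b^4(k+1)^2+b^2$. - For $g:\mathbb{N}\to\mathbb{N}$: $\omega_g(m):=\max\{g(12b(m+1)^2),\,12b(m+1)^2\}+1$. - For $k\in\mathbb{N}$, $g:\mathbb{N}\to\mathbb{N}$: $\gamma_{k,g}(m):=\max\{g(m),\,2b(k+1)\}$. - $\beta_0(k,g):=12b\left(\omega_{\gamma_{k,g}}^{(r(2k+1))}(0)+1\right)^2$, and $\beta(k,g):=3\beta_0(k,g')+2$ where $g'(m):=g(3m+2)$. - $\chi(k):=\nu\left(\xi(2b(k+1))+1+\ell+\lceil\ln(2b(k+1))\rceil\right)$.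 - $\widetilde{\alpha}(k):=\max\{\mu(2\ell b(k+1)),\,\chi(2k+1)\}$ and $\widehat{\alpha}(k):=\widetilde{\alpha}(\tau(k))$. - $\psi(k,g):=\widehat{\alpha}\left(\beta(k,\widehat{g})\right)$, where $\widehat{g}(m):=g(\widehat{\alpha}(m))$. - $\sigma'(k,n):=\nu\left(\widetilde{n}+1+\lceil\ln(3b^2(k+1)^2)\rceil\right)$, with $\widetilde{n}:=\max\{n,\,\mu(6b^2(k+1)^2)\}$. *)

(* Defs.v *)
From mathcomp Require Import all_boot all_order all_algebra.
From mathcomp Require Import all_classical all_reals all_analysis.
Import numFieldNormedType.Exports.

Set Implicit Arguments.
Unset Strict Implicit.
Unset Printing Implicit Defensive.

Import Order.TTheory GRing.Theory Num.Theory.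

Local Open Scope classical_set_scope.
Local Open Scope ring_scope.

(* The analysis library has no Hilbert spaces: a (real) Hilbert space is given
   by a complete normed module X over R and an inner product on X (positive
   definite symmetric bilinear form) that induces the norm of X. *)
Definition induces_norm (R : realType) (X : completeNormedModType R)
    (dot : {dot X for (idfun : R -> R)}) : Prop :=
  forall x : X, `|x| ^+ 2 = dot x x.

Definition nonexpansive_on (R : realType) (X : normedModType R)
    (C : set X) (T : X -> X) : Prop :=
  forall x y : X, C x -> C y -> `|T x - T y| <= `|x - y|.

Definition monotone_nat (f : nat -> nat) : Prop :=
  {homo f : k n / (k <= n)%N}.

Definition cyclic_maps (X : Type) (l : nat) (T : nat -> X -> X) (n : nat) :
    X -> X := T (n %% l)%N.

(* U (m + n) \o ... \o U (m + 1), and the identity when n = 0 *)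
Fixpoint comp_from (X : Type) (U : nat -> X -> X) (m n : nat) : X -> X :=
  if n is n'.+1 then U (m + n'.+1)%N \o comp_from U m n' else id.

Fixpoint halpern (R : realType) (X : normedModType R) (lambda : nat -> R)
    (U : nat -> X -> X) (u0 : X) (n : nat) : X :=
  if n is n'.+1 then
    lambda n'.+1 *: u0
      + (1 - lambda n'.+1) *: U n'.+1 (halpern lambda U u0 n')
  else u0.

(* The ceiling of ln n is an int; it is nonnegative for n >= 1, the only case
   used below when b >= 1, so the absolute value only changes the type. *)
Definition ceil_ln (R : realType) (n : nat) : nat :=
  `|Num.ceil (ln (n%:R : R))|%N.

Local Open Scope nat_scope.

Definition r_fun (b k : nat) : nat := b ^ 4 * (k + 1) ^ 2 + b ^ 2.

Definition omega (b : nat) (g : nat -> nat) (m : nat) : nat :=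
  maxn (g (12 * b * (m + 1) ^ 2)) (12 * b * (m + 1) ^ 2) + 1.

Definition gamma (b k : nat) (g : nat -> nat) (m : nat) : nat :=
  maxn (g m) (2 * b * (k + 1)).

Definition beta0 (b k : nat) (g : nat -> nat) : nat :=
  12 * b * (iter (r_fun b (2 * k + 1)) (omega b (gamma b k g)) 0 + 1) ^ 2.

Definition beta (b k : nat) (g : nat -> nat) : nat :=
  3 * beta0 b k (fun m => g (3 * m + 2)) + 2.

Definition chi (R : realType) (b l : nat) (nu xi : nat -> nat) (k : nat) :
    nat :=
  nu (xi (2 * b * (k + 1)) + 1 + l + ceil_ln R (2 * b * (k + 1))).

Definition alpha_tilde (R : realType) (b l : nat) (mu nu xi : nat -> nat)
    (k : nat) : nat :=
  maxn (mu (2 * l * b * (k + 1))) (chi R b l nu xi (2 * k + 1)).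

Definition alpha_hat (R : realType) (b l : nat) (mu nu xi tau : nat -> nat)
    (k : nat) : nat :=
  alpha_tilde R b l mu nu xi (tau k).

Definition psi (R : realType) (b l : nat) (mu nu xi tau : nat -> nat)
    (k : nat) (g : nat -> nat) : nat :=
  alpha_hat R b l mu nu xi tau
    (beta b k (fun m => g (alpha_hat R b l mu nu xi tau m))).

Definition sigma' (R : realType) (b : nat) (mu nu : nat -> nat) (k n : nat) :
    nat :=
  nu (maxn n (mu (6 * b ^ 2 * (k + 1) ^ 2)) + 1
      + ceil_ln R (3 * b ^ 2 * (k + 1) ^ 2)).

Definition f_bar (R : realType) (b : nat) (mu nu : nat -> nat) (k : nat)
    (f : nat -> nat) (m : nat) : nat :=
  36 * b * (k + 1) ^ 2 * (f (sigma' R b mu nu (2 * k + 1) m) + 1) - 1.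

Definition phi (R : realType) (b l : nat) (mu nu xi tau : nat -> nat)
    (k : nat) (f : nat -> nat) : nat :=
  sigma' R b mu nu (2 * k + 1)
    (psi R b l mu nu xi tau (48 * (k + 1) ^ 2 - 1) (f_bar R b mu nu k f)).

(* Main.v *)
Require Import Defs.
From mathcomp Require Import all_boot all_order all_algebra.
From mathcomp Require Import all_classical all_reals all_analysis.
From mathcomp Require Import ring lra zify.
Import Order.TTheory GRing.Theory Num.Theory.
Import numFieldNormedType.Exports.

Local Open Scope classical_set_scope.
Local Open Scope ring_scope.

(* Let F(n) be the set of points of C moved at most 1/(n+1) by every T_i.
   Instead of projecting u0 on the common fixed points, follow the chain
   F(a 0), F(a 1), ... with a j the j-th iterate of omega at 0: a squared
   distance bounded by b^2 cannot drop by e > b^2/r along r consecutive links,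
   so on some link a point x of F(a (j+1)) is e-optimal within F(a j).
   A convex combination of points of F(12b(m+1)^2) lies in F(m), so x satisfies
   the variational inequality of a projection, up to an error, on the whole of
   F(12b(a j + 1)^2).  Since u is asymptotically regular, it eventually enters
   that set, so weak limit points are not needed, and the recursive inequality
   for |u_n - x|^2 forces u_i to be close to x on the required interval. *)

(** * Recursive inequalities and products of real sequences *)

Section RealSequences.
Context {R : realType}.
Implicit Types (a s c : nat -> R) (d B : R).

(** The constant [d] is the fixed point of the map [s -> (1 - a) s + a d], so the product damps only
    the initial bound [B]; the errors [c j], multiplied by factors below 1, at most add up. *)
Lemma affine_rec_le a s c d B M :
  (forall n, 0 < a n < 1) -> 0 <= d -> (forall n, 0 <= c n) -> s M <= B ->
  (forall n, (M <= n)%N -> s n.+1 <= (1 - a n.+1) * s n + a n.+1 * d + c n.+1) ->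
  forall n, (M <= n)%N ->
    s n <= \prod_(M.+1 <= j < n.+1) (1 - a j) * B + d
           + \sum_(M.+1 <= j < n.+1) c j.
Proof.
move=> a01 d0 c0 sM rec n /subnKC <-.
elim: (n - M)%N => [|{}n IH].
  by rewrite addn0 !big_geq// mul1r addr0; lra.
have MMn : (M.+1 <= (M + n).+1)%N by rewrite ltnS leq_addr.
rewrite addnS [X in X * B]big_nat_recr//= [X in _ + X]big_nat_recr//=.
have := rec (M + n)%N (leq_addr _ _).
set p := \prod_(_ <= _ < _) _ in IH *; set q := \sum_(_ <= _ < _) _ in IH *.
have q0 : 0 <= q by apply: sumr_ge0.
have /andP[a0 a1] := a01 (M + n).+1.
have : (1 - a (M + n).+1) * s (M + n)%N
    <= (1 - a (M + n).+1) * (p * B + d + q) by rewrite ler_pM2l//; lra.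
have : 0 <= a (M + n).+1 * q by rewrite mulr_ge0// ltW.
move=> h1 h2 h3; apply: (le_trans h3).
apply: (le_trans (lerD (lerD h2 (lexx _)) (lexx _))).
lra.
Qed.

Lemma prod_oneminus_le_expR a m n :
  (forall n, 0 < a n < 1) ->
  \prod_(m <= j < n) (1 - a j) <= expR (- \sum_(m <= j < n) a j).
Proof.
move=> a01; rewrite -sumrN expR_sum.
apply: ler_prod => j _; have /andP[a0 a1] := a01 j.
by rewrite subr_ge0 ltW//= expR_ge1Dx.
Qed.

(** All terms are below 1, so those before [m] use up at most [m] of the sum and at least [ln K]
    remains from [m] on; the product is then at most [expR (- ln K)]. Counting terms in the same way
    gives [m <= n.+1]. *)
Lemma prod_oneminus_rate a (nu : nat -> nat) m n K :
  (forall n, 0 < a n < 1) ->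
  (forall k : nat, \sum_(0 <= j < (nu k).+1) a j >= k%:R) ->
  (0 < K)%N -> (nu (m + ceil_ln R K) <= n)%N ->
  (m <= n.+1)%N /\ \prod_(m <= j < n.+1) (1 - a j) <= K%:R^-1.
Proof.
move=> a01 hnu K0 nun.
have sum_le p q : \sum_(p <= j < q) a j <= (q - p)%:R.
  have <- : \sum_(p <= j < q) (1 : R) = (q - p)%:R by rewrite sumr_const_nat.
  by apply: ler_sum => j _; have /andP[_ /ltW] := a01 j.
have ge : (m + ceil_ln R K)%:R <= \sum_(0 <= j < n.+1) a j.
  apply: le_trans (hnu _) _.
  rewrite [leRHS](@big_cat_nat _ _ _ (nu (m + ceil_ln R K)).+1)//=.
  by rewrite lerDl; apply: sumr_ge0 => j _; have /andP[/ltW] := a01 j.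
have mn : (m <= n.+1)%N.
  rewrite -(ler_nat R); apply: le_trans (sum_le 0 n.+1); apply: le_trans ge.
  by rewrite ler_nat leq_addr.
split=> //; apply: (le_trans (prod_oneminus_le_expR _ _ _ a01)).
have lnK_le : ln (K%:R : R) <= (ceil_ln R K)%:R.
  rewrite /ceil_ln natr_absz ger0_norm ?ceil_ge//.
  by rewrite ceil_ge0 (lt_le_trans (ltrN10 _))// ln_ge0 ?ler1n.
rewrite -[K%:R]lnK ?posrE ?ltr0n// -expRN ler_expR lerN2.
apply: (le_trans lnK_le).
move: ge; rewrite (@big_cat_nat _ _ _ m)//= natrD.
have := sum_le 0%N m; rewrite subn0; lra.
Qed.

End RealSequences.

Lemma ceil_ln_mono (R : realType) m n :
  (0 < m)%N -> (m <= n)%N -> (ceil_ln R m <= ceil_ln R n)%N.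
Proof.
move=> m0 mn; have n0 := leq_trans m0 mn.
have ceil0 p : (0 < p)%N -> 0 <= Num.ceil (ln (p%:R : R)).
  by move=> p0; rewrite ceil_ge0 (lt_le_trans (ltrN10 _))// ln_ge0 ?ler1n.
rewrite -lez_nat !gez0_abs ?ceil0// le_ceil//.
by rewrite ler_ln ?posrE ?ltr0n// ler_nat.
Qed.

(** * Inner product identities and nonexpansive maps *)

Section Hilbert.
Context {R : realType} {X : completeNormedModType R}.
Context {dot : {dot X for (idfun : R -> R)}} (hX : induces_norm dot).
Implicit Types (x y z : X) (t : R).

Lemma dotC x y : dot x y = dot y x.
Proof. by rewrite hermC/= mul1r. Qed.

Lemma sqr_normD x y : `|x + y| ^+ 2 = `|x| ^+ 2 + `|y| ^+ 2 + 2 * dot x y.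
Proof. by rewrite !hX linearDl/= !linearDr/= (dotC y x); ring. Qed.

Lemma sqr_normZ t x : `|t *: x| ^+ 2 = t ^+ 2 * `|x| ^+ 2.
Proof. by rewrite normrZ exprMn real_normK// num_real. Qed.

(** Translation by [z] reduces this to expanding squares. The negative term, which expresses uniform
    convexity, controls [T] at convex combinations and later yields the variational inequality. *)
Lemma sqr_norm_conv t x y z :
  `|(1 - t) *: x + t *: y - z| ^+ 2 =
  (1 - t) * `|x - z| ^+ 2 + t * `|y - z| ^+ 2 - t * (1 - t) * `|x - y| ^+ 2.
Proof.
have -> : (1 - t) *: x + t *: y - z = (1 - t) *: (x - z) + t *: (y - z).
  by rewrite !scalerBr addrACA -opprD -scalerDl subrK scale1r.
have -> : x - y = (x - z) - (y - z) by rewrite opprB addrA subrK.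
move: (x - z) (y - z) => {x y z} x y.
rewrite !sqr_normD !sqr_normZ normrN.
by rewrite (linearZl_LR dot)/= (linearZr_LR dot)/= linearNr/=; ring.
Qed.

(** The two sides differ by the square of the norm of [y]. *)
Lemma sqr_normD_le x y : `|x + y| ^+ 2 <= `|x| ^+ 2 + 2 * dot y (x + y).
Proof.
rewrite sqr_normD linearDr/= -hX (dotC y x).
by have := sqr_ge0 `|y|; lra.
Qed.

(** Let [w] be the combination. The distances from [x] and [y] to [T w] exceed those to [w] by at
    most [e]. In the expansion by [sqr_norm_conv] the terms in [|x - y|^2] then cancel, which leaves
    [e^2 + 4 t (1 - t) e |x - y|], and [4 t (1 - t) <= 1]. *)
Lemma nonexpansive_conv_defect {C : set X} {T : X -> X} {t x y} {d e : R} :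
  nonexpansive_on C T -> 0 <= t <= 1 -> C x -> C y ->
  C ((1 - t) *: x + t *: y) -> `|x - y| <= d ->
  `|x - T x| <= e -> `|y - T y| <= e ->
  `|(1 - t) *: x + t *: y - T ((1 - t) *: x + t *: y)| ^+ 2 <= d * e + e ^+ 2.
Proof.
move=> Tne /andP[t0 t1] Cx Cy; set w := _ + _ => Cw xyd xe ye.
rewrite {1}/w sqr_norm_conv.
have dist z : C z -> `|z - T z| <= e -> `|z - T w| <= e + `|z - w|.
  move=> Cz ze; apply: le_trans (lerD ze (Tne _ _ Cz Cw)).
  by rewrite -[z - T w](subrKA (T z)) ler_normD.
have xw : `|x - w| = t * `|x - y|.
  have -> : x - w = t *: (x - y).
    by rewrite /w scalerBl scale1r scalerBr opprD opprB addrA addrCA subrr addr0.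
  by rewrite normrZ ger0_norm.
have yw : `|y - w| = (1 - t) * `|x - y|.
  have -> : y - w = (1 - t) *: (y - x).
    by rewrite /w scalerBr [in RHS](scalerBl 1 t y) scale1r opprD addrCA addrC.
  by rewrite normrZ ger0_norm ?subr_ge0// distrC.
have := dist x Cx xe; have := dist y Cy ye; rewrite xw yw => hy hx.
have sq (p q : R) : 0 <= p -> p <= q -> p ^+ 2 <= q ^+ 2.
  by move=> p0 pq; rewrite lerXn2r// nnegrE// (le_trans p0).
have hx2 : (1 - t) * `|x - T w| ^+ 2 <= (1 - t) * (e + t * `|x - y|) ^+ 2.
  by rewrite ler_wpM2l ?subr_ge0// sq.
have hy2 : t * `|y - T w| ^+ 2 <= t * (e + (1 - t) * `|x - y|) ^+ 2.
  by rewrite ler_wpM2l// sq.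
have e0 : 0 <= e by apply: le_trans xe.
have n0 : 0 <= `|x - y| by [].
have ed : e * `|x - y| <= e * d by rewrite ler_wpM2l.
have t4 : 4 * (t * (1 - t)) <= 1 by have := sqr_ge0 (1 - 2 * t); nra.
have en : 0 <= e * `|x - y| by rewrite mulr_ge0.
have : 4 * (t * (1 - t)) * (e * `|x - y|) <= e * `|x - y|.
  by rewrite -[leRHS]mul1r ler_wpM2r.
nra.
Qed.

End Hilbert.

Lemma convex_set_comb {R : realType} {X : lmodType R} {C : set X} {t : R} {x y : X} :
  convex_set C -> 0 <= t <= 1 -> C x -> C y -> C ((1 - t) *: x + t *: y).
Proof.
move=> Cc /andP[t0 t1] Cx Cy.
have := Cc y x (Itv01 t0 t1); rewrite !inE => /(_ Cy Cx).
by rewrite addrC.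
Qed.

(** * Approximate projection onto sets of approximate fixed points *)

Section ApproximateProjection.
Context {R : realType} {X : completeNormedModType R}.
Context {dot : {dot X for (idfun : R -> R)}} (hX : induces_norm dot).
Context {C : set X} (Cconvex : convex_set C).
Context {b : nat} (b_gt0 : (0 < b)%N).
Context (diamC : forall x y, C x -> C y -> `|x - y| <= b%:R :> R).
Context {l : nat} {T : nat -> X -> X}.
Context (Tne : forall i, (i < l)%N -> nonexpansive_on C (T i)).

Definition approx_fix (n : nat) : set X :=
  [set x | C x /\ forall i, (i < l)%N -> `|x - T i x| <= n.+1%:R^-1 :> R].

Lemma approx_fix_le m n : (m <= n)%N -> approx_fix n `<=` approx_fix m.
Proof.
move=> mn x [Cx xn]; split=> // i /xn /le_trans; apply.
by rewrite lef_pV2 ?posrE ?ltr0n// ler_nat ltnS.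
Qed.

Lemma approx_fix_conv m (t : R) x y :
  0 <= t <= 1 ->
  approx_fix (12 * b * (m + 1) ^ 2) x -> approx_fix (12 * b * (m + 1) ^ 2) y ->
  approx_fix m ((1 - t) *: x + t *: y).
Proof.
move=> t01 [Cx xn] [Cy yn].
have Cw := convex_set_comb Cconvex t01 Cx Cy; split=> // i il.
have sq := nonexpansive_conv_defect hX (Tne i il) t01 Cx Cy Cw
  (diamC _ _ Cx Cy) (xn i il) (yn i il).
rewrite -(@ler_pXn2r _ 2)// ?nnegrE ?invr_ge0//; apply: le_trans sq _.
(* It remains to see [b / c + 1 / c^2 <= 1 / (m + 1)^2]; the summands are at most 1/12 and 1/2 of
   the right-hand side. *)
set c : R := (12 * b * (m + 1) ^ 2).+1%:R.
have m0 : 0 < m.+1%:R :> R by rewrite ltr0n.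
have b0 : 1 <= b%:R :> R by rewrite ler1n.
have cE : c = 12 * b%:R * m.+1%:R ^+ 2 + 1.
  by rewrite /c -natr1 natrM natrX natrM addn1.
have m2 : 1 <= m.+1%:R ^+ 2 :> R by rewrite expr_ge1// ?ler1n.
have c12 : 12 * b%:R * m.+1%:R ^+ 2 <= c by rewrite cE; lra.
have c2 : 2 * m.+1%:R ^+ 2 <= c by nra.
have c0 : 0 < c by rewrite ltr0n.
have i0 : 0 < c^-1 by rewrite invr_gt0.
have ic : c^-1 * c = 1 by rewrite mulVf ?gt_eqF.
have i1 : c^-1 <= 1 by rewrite invf_le1//; nra.
rewrite [leRHS]exprVn -[leRHS]mul1r ler_pdivlMr ?exprn_gt0//.
have h12 : c^-1 * (12 * b%:R * m.+1%:R ^+ 2) <= 1 by rewrite -[leRHS]ic ler_pM2l.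
have h2 : c^-1 * (2 * m.+1%:R ^+ 2) <= 1 by rewrite -[leRHS]ic ler_pM2l.
have : c^-1 * (c^-1 * (2 * m.+1%:R ^+ 2)) <= 1.
  by rewrite mulr_ile1// ltW// mulr_gt0// ltr_pMr.
move: h12; move: (c^-1) (m.+1%:R ^+ 2) => p M; nra.
Qed.

Lemma approx_proj_descent (u0 : X) (a : nat -> nat) (r : nat) (e : R) :
  C u0 -> (forall n, approx_fix n !=set0) -> b%:R ^+ 2 < r%:R * e ->
  exists2 j, (j < r)%N & exists2 x, approx_fix (a j.+1) x &
    forall y, approx_fix (a j) y -> `|x - u0| ^+ 2 <= `|y - u0| ^+ 2 + e.
Proof.
move=> Cu0 ne bre; apply: contrapT => hn.
(* Here [j] counts links backwards from [approx_fix (a r)]; each failing link supplies a point whose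
   squared distance to [u0] is smaller by more than [e]. The case [j = r] contradicts
   [b^2 < r e]. *)
have step j : (j <= r)%N ->
    exists2 x, approx_fix (a (r - j)%N) x & `|x - u0| ^+ 2 + j%:R * e <= b%:R ^+ 2.
  elim: j => [_|j IH jr].
    have [x Fx] := ne (a r); exists x; rewrite ?subn0// mul0r addr0.
    by rewrite lerXn2r ?nnegrE// diamC//; case: Fx.
  have [x Fx xe] := IH (ltnW jr); apply: contrapT => hx; apply: hn.
  exists (r - j.+1)%N; first by rewrite ltn_subrL; lia.
  exists x; first by rewrite subnSK.
  move=> y Fy; rewrite leNgt; apply/negP => yx; apply: hx; exists y => //.
  by rewrite -natr1; lra.
have [x _] := step r (leqnn r).
by have := sqr_ge0 `|x - u0|; lra.
Qed.

(* The error [t^2 b^2] allowed to [x] matches the quadratic term of the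
   expansion in [t], so dividing by [2 t] leaves [t b^2]. *)
Lemma variational_ineq (t : R) (u0 x y : X) :
  0 < t <= 1 -> C x -> C y ->
  `|x - u0| ^+ 2 <= `|(1 - t) *: x + t *: y - u0| ^+ 2 + t ^+ 2 * b%:R ^+ 2 ->
  dot (u0 - x) (y - x) <= t * b%:R ^+ 2.
Proof.
move=> /andP[t0 t1] Cx Cy; rewrite (sqr_norm_conv hX).
have -> : `|y - u0| ^+ 2 =
    `|x - y| ^+ 2 + `|x - u0| ^+ 2 - 2 * dot (u0 - x) (y - x).
  have -> : y - u0 = (y - x) - (u0 - x) by rewrite opprB addrA subrK.
  rewrite (sqr_normD hX) linearNr/= normrN (dotC (y - x)).
  by rewrite (distrC y x) (distrC u0 x); ring.
have d2 : `|x - y| ^+ 2 <= b%:R ^+ 2 by rewrite lerXn2r ?nnegrE// diamC.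
set D := dot _ _; set p := `|_| ^+ 2; set q := `|_| ^+ 2 in d2 * => h.
rewrite -(@ler_pM2l _ (2 * t)) ?mulr_gt0//.
have : t ^+ 2 * q <= t ^+ 2 * b%:R ^+ 2 by rewrite ler_wpM2l ?sqr_ge0.
nra.
Qed.

Lemma approx_proj (u0 : X) k (g : nat -> nat) :
  C u0 -> (forall n, approx_fix n !=set0) ->
  exists2 n, (n <= beta0 b k g)%N & exists2 x, approx_fix (g n) x &
    forall y, approx_fix n y -> dot (u0 - x) (y - x) <= k.+1%:R^-1.
Proof.
move=> Cu0 ne; pose a j := iter j (omega b (gamma b k g)) 0%N.
have b0 : 1 <= b%:R :> R by rewrite ler1n.
have b2 : 1 <= b%:R ^+ 2 :> R by rewrite expr_ge1.
(* This [t] makes the variational error [t b^2] equal to [1 / (k + 1)]. The optimality error is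
   [e = t^2 b^2 = 1 / (b (k + 1))^2], and [b^2 / e = b^4 (k + 1)^2] is below the number of links
   [r_fun b (2 k + 1)]. *)
pose t : R := (b%:R ^+ 2 * k.+1%:R)^-1.
have k1 : 1 <= k.+1%:R :> R by rewrite ler1n.
have t01 : 0 < t <= 1.
  rewrite invr_gt0 mulr_gt0 ?(lt_le_trans ltr01)//=.
  by rewrite invf_le1 ?mulr_gt0 ?(lt_le_trans ltr01)// mulr_ege1.
have tb : t * b%:R ^+ 2 = k.+1%:R^-1.
  by rewrite /t invfM mulrAC mulVf ?mul1r// gt_eqF// (lt_le_trans ltr01).
have [|j jr [x Fx xmin]] :=
    approx_proj_descent u0 a (r_fun b (2 * k + 1)) (t ^+ 2 * b%:R ^+ 2) Cu0 ne.
  rewrite [t ^+ 2]expr2 -mulrA tb /t /r_fun.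
  rewrite -invfM ltr_pdivlMr ?mulr_gt0 ?(lt_le_trans ltr01)//.
  rewrite natrD natrM !natrX addn1 (_ : (2 * k + 1).+1 = (2 * k.+1)%N); last by lia.
  rewrite natrM; move: k1 b2; set K := k.+1%:R => k1 b2.
  have -> : b%:R ^+ 4 = b%:R ^+ 2 * b%:R ^+ 2 :> R by rewrite -exprD.
  move: b2; move: (b%:R ^+ 2) => B b2.
  have : 0 <= (B * K) ^+ 2 by rewrite sqr_ge0.
  nra.
pose n := (12 * b * (a j + 1) ^ 2)%N.
(* Exceeding [g n] gives the required quality of [x]. Exceeding [n] puts [x], like [y], in
   [approx_fix n], so that the segment between them stays in [approx_fix (a j)], where [x] is nearly
   optimal. *)
have aS : a j.+1 = (maxn (maxn (g n) (2 * b * (k + 1))) n + 1)%N by [].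
have amono : {homo a : i j / (i <= j)%N}.
  apply: homo_leq => [//|? ? ?|i]; first exact: leq_trans.
  rewrite /a/= /omega; set m := iter _ _ _; nia.
exists n.
  by rewrite /beta0 leq_mul2l leq_exp2r// leq_add2r amono ?orbT// ltnW.
exists x; first by apply: approx_fix_le Fx; rewrite aS; lia.
have Fnx : approx_fix n x by apply: approx_fix_le Fx; rewrite aS; lia.
move=> y Fy; rewrite -tb.
have [Cx Cy] : C x /\ C y by case: Fnx; case: Fy.
apply: variational_ineq => //; apply: xmin; apply: approx_fix_conv => //.
by case/andP: t01 => /ltW ->.
Qed.

End ApproximateProjection.

(** * The Halpern iteration for a cyclic family of maps *)

Section Halpern.
Context {R : realType} {X : completeNormedModType R}.
Context {dot : {dot X for (idfun : R -> R)}} (hX : induces_norm dot).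
Context {l : nat} (l_gt0 : (0 < l)%N).
Context {C : set X} (Cconvex : convex_set C).
Context {b : nat} (b_gt0 : (0 < b)%N).
Context (diamC : forall x y, C x -> C y -> `|x - y| <= b%:R :> R).
Context {T : nat -> X -> X}.
Context (Tself : forall i, (i < l)%N -> set_fun C C (T i)).
Context (Tne : forall i, (i < l)%N -> nonexpansive_on C (T i)).
Context {lambda : nat -> R} (lambda01 : forall n, 0 < lambda n < 1).
Context {u0 : X} (Cu0 : C u0).

Let U := cyclic_maps l T.
Let u := halpern lambda U u0.
Let AF := @approx_fix R X C l T.

Lemma cyclic_self n x : C x -> C (U n x).
Proof. by apply: Tself; rewrite ltn_mod. Qed.

Lemma cyclic_ne n : nonexpansive_on C (U n).
Proof. by apply: Tne; rewrite ltn_mod. Qed.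

Lemma comp_from_self m n x : C x -> C (comp_from U m n x).
Proof. by elim: n => [//|n IH] Cx /=; apply: cyclic_self; exact: IH. Qed.

Lemma halpernS n :
  u n.+1 = (1 - lambda n.+1) *: U n.+1 (u n) + lambda n.+1 *: u0.
Proof. by rewrite addrC. Qed.

Lemma halpern_in n : C (u n).
Proof.
elim: n => [//|n IH]; rewrite halpernS; apply: convex_set_comb => //.
- by have /andP[/ltW -> /ltW ->] := lambda01 n.+1.
- exact: cyclic_self.
Qed.

Lemma halpern_cyclic_dist n : `|u n.+1 - U n.+1 (u n)| <= lambda n.+1 * b%:R.
Proof.
have /andP[la0 _] := lambda01 n.+1.
have -> : u n.+1 - U n.+1 (u n) = lambda n.+1 *: (u0 - U n.+1 (u n)).
  by rewrite halpernS scalerBl scale1r scalerBr addrAC [_ - _ - _]addrAC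
    subrr sub0r addrC.
rewrite normrZ gtr0_norm// ler_pM2l//; apply: diamC => //.
exact/cyclic_self/halpern_in.
Qed.

(** Each step adds a new error of at most [lambda i * b], and nonexpansiveness keeps the earlier
    errors from growing. *)
Lemma halpern_comp_from_dist n j :
  `|u (n + j) - comp_from U n j (u n)|
    <= (\sum_(n.+1 <= i < (n + j).+1) lambda i) * b%:R.
Proof.
elim: j => [|j IH]; first by rewrite addn0 subrr normr0 big_geq// mul0r.
have nj : (n.+1 <= (n + j).+1)%N by rewrite ltnS leq_addr.
rewrite addnS big_nat_recr//= mulrDl -[u _.+1 - _](subrKA (U (n + j).+1 (u (n + j)))).
apply: le_trans (ler_normD _ _) _; rewrite [leLHS]addrC.
rewrite lerD//; last exact: halpern_cyclic_dist.
rewrite addnS; apply: le_trans IH; apply: cyclic_ne; first exact: halpern_in.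
exact/comp_from_self/halpern_in.
Qed.

(** Periodicity gives both indices the same nonexpansive map; the rest of the difference is the
    change of coefficient times [U n.+1 (u n) - u0], a vector of norm at most [b]. *)
Lemma halpern_shift_dist n :
  `|u (n.+1 + l) - u n.+1| <=
    (1 - lambda (n.+1 + l)) * `|u (n + l) - u n|
    + `|lambda n.+1 - lambda (n.+1 + l)| * b%:R.
Proof.
have /andP[_ la1] := lambda01 (n.+1 + l)%N.
have Ul x : U (n + l).+1 x = U n.+1 x by rewrite /U /cyclic_maps -addSn modnDr.
have -> : u (n.+1 + l)%N - u n.+1 =
    (1 - lambda (n.+1 + l)%N) *: (U n.+1 (u (n + l)%N) - U n.+1 (u n))
    + (lambda n.+1 - lambda (n.+1 + l)%N) *: (U n.+1 (u n) - u0).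
  rewrite addSn !halpernS Ul.
  set p := lambda n.+1; set q := lambda _.
  set x := U _ (u (n + l)%N); set y := U _ (u n).
  have -> : (1 - p) *: y = (1 - q) *: y - (p - q) *: y.
    by rewrite -scalerBl opprB addrA subrK.
  rewrite [- (_ + _)]opprD addrACA -(scalerBl q p) -[q - p]opprB scaleNr opprB.
  by rewrite !scalerBr !addrA; congr (_ - _); rewrite addrAC.
apply: le_trans (ler_normD _ _) _; rewrite !normrZ.
rewrite [`|1 - _|]ger0_norm ?subr_ge0; last exact: ltW.
rewrite lerD//.
- rewrite ler_pM2l ?subr_gt0//; apply: cyclic_ne; exact: halpern_in.
- by rewrite ler_wpM2l//; apply: diamC => //; apply/cyclic_self/halpern_in.
Qed.

(** * Asymptotic regularity with rates, and the variational inequality along the iterates *)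

Section Rates.
Context {mu nu xi tau : nat -> nat}.
Context (mu_mono : monotone_nat mu) (nu_mono : monotone_nat nu).
Context (xi_mono : monotone_nat xi) (tau_mono : monotone_nat tau).
Context (hmu : forall k n, (mu k <= n)%N -> lambda n <= k.+1%:R^-1).
Context (hnu : forall k, \sum_(0 <= j < (nu k).+1) lambda j >= k%:R).
Context (hxi : forall k n, (1 <= n)%N ->
  \sum_((xi k).+1 <= j < (xi k + n).+1) `|lambda j - lambda (j + l)%N|
    <= k.+1%:R^-1).
Context (htau : forall k m x, C x ->
  `|x - comp_from U m l x| <= (tau k).+1%:R^-1 ->
  forall i, (i < l)%N -> `|x - U i x| < k.+1%:R^-1).

Let b_pos : 0 < b%:R :> R. Proof. by rewrite ltr0n. Qed.

(** [affine_rec_le] applies with [d = 0]: the damped initial distance and the variation of the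
    coefficients after [M] contribute at most [1 / (2 (k + 1))] each. *)
Lemma halpern_chi k n : (chi R b l nu xi k <= n)%N ->
  `|u (n + l) - u n| <= k.+1%:R^-1.
Proof.
rewrite /chi; set M := xi _ => hn.
have K0 : (0 < 2 * b * (k + 1))%N by lia.
(* The recursion contracts by [1 - lambda (j + l)], so its product from [M + 1] to [n] is the
   product of [1 - lambda j] from [M + 1 + l] to [n + l]. *)
have [Mn prod_le] := prod_oneminus_rate lambda nu (M + 1 + l) (n + l) _
  lambda01 hnu K0 (leq_trans hn (leq_addr _ _)).
have {}Mn : (M <= n)%N by lia.
have rec := affine_rec_le (fun j => lambda (j + l)%N)
  (fun n => `|u (n + l)%N - u n|)
  (fun n => `|lambda n - lambda (n + l)%N| * b%:R) 0 b%:R M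
  (fun n => lambda01 (n + l)) (lexx _).
apply: le_trans (rec _ _ _ n Mn) _.
- by move=> j; rewrite mulr_ge0.
- by apply: diamC; exact: halpern_in.
- by move=> j _; rewrite mulr0 addr0; exact: halpern_shift_dist.
rewrite addr0 -mulr_suml -mulrDl.
have -> : \prod_(M.+1 <= j < n.+1) (1 - lambda (j + l)%N) =
    \prod_(M + 1 + l <= j < (n + l).+1) (1 - lambda j).
  by rewrite [RHS](big_addn _ _ l) addn1 -addSn addnK.
have sum_le : \sum_(M.+1 <= j < n.+1) `|lambda j - lambda (j + l)%N|
    <= (2 * b * (k + 1))%:R^-1.
  (* The rate [xi] speaks of nonempty sums, hence the separate case [n = M]. *)
  rewrite -(subnKC Mn); have [->|nM] := posnP (n - M)%N.
    by rewrite addn0 big_geq// invr_ge0.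
  apply: (le_trans (hxi _ _ nM)).
  by rewrite lef_pV2 ?posrE ?ltr0n// ler_nat.
apply: le_trans (_ : ((2 * b * (k + 1))%:R^-1 + (2 * b * (k + 1))%:R^-1) * b%:R <= _).
  by rewrite ler_pM2r// lerD.
have K1 : k.+1%:R != 0 :> R by rewrite pnatr_eq0.
have b1 : b%:R != 0 :> R by rewrite gt_eqF.
rewrite !natrM addn1 le_eqVlt; apply/orP; left; apply/eqP.
move: K1 b1; move: k.+1%:R b%:R => K B K1 B1; field.
by rewrite K1 B1.
Qed.

(** The triangle inequality through [u (n + l)]: its distance to [u n] takes half of the error, and
    the other half covers [l] coefficients of size at most [1 / (2 l b (k + 1))], each multiplied by
    [b]. *)
Lemma halpern_alpha_tilde k n : (alpha_tilde R b l mu nu xi k <= n)%N ->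
  `|u n - comp_from U n l (u n)| <= k.+1%:R^-1.
Proof.
rewrite geq_max => /andP[hm /halpern_chi hc].
rewrite -(subrKA (u (n + l)%N)); apply: le_trans (ler_normD _ _) _.
apply: le_trans (lerD _ (halpern_comp_from_dist n l)) _.
  by rewrite distrC; exact: hc.
apply: le_trans (_ : (2 * k + 1).+1%:R^-1
  + (\sum_(n.+1 <= i < (n + l).+1) (2 * l * b * (k + 1)).+1%:R^-1) * b%:R <= _).
  rewrite lerD2l ler_pM2r// ler_sum_nat// => j /andP[nj _].
  by apply: hmu; exact: leq_trans hm (ltnW nj).
rewrite sumr_const_nat subSS addKn -(mulr_natl _ l).
have K1 : k.+1%:R != 0 :> R by rewrite pnatr_eq0.
have b1 : b%:R != 0 :> R by rewrite gt_eqF.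
have l1 : l%:R != 0 :> R by rewrite pnatr_eq0 -lt0n.
apply: le_trans (_ : (2 * k.+1%:R)^-1
    + l%:R * (2 * l%:R * b%:R * k.+1%:R)^-1 * b%:R <= _).
  have inv_le (p q : nat) : (0 < q)%N -> (q <= p)%N -> p%:R^-1 <= q%:R^-1 :> R.
    by move=> q0 qp; rewrite lef_pV2 ?posrE ?ltr0n ?(leq_trans q0)// ler_nat.
  rewrite -!natrM lerD//; first by apply: inv_le; lia.
  rewrite ler_pM2r// ler_pM2l ?ltr0n//; apply: inv_le; last by lia.
  by rewrite !muln_gt0 l_gt0 b_gt0.
rewrite le_eqVlt; apply/orP; left; apply/eqP.
move: K1 b1 l1; move: k.+1%:R b%:R l%:R => K B L K1 B1 L1; field.
by rewrite K1 B1 L1.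
Qed.

Lemma halpern_alpha_hat k n : (alpha_hat R b l mu nu xi tau k <= n)%N ->
  AF k (u n).
Proof.
move=> /halpern_alpha_tilde hn; split=> [|i il]; first exact: halpern_in.
have := htau k n _ (halpern_in n) hn i il.
by rewrite /U /cyclic_maps modn_small// => /ltW.
Qed.

Lemma alpha_hat_mono : monotone_nat (alpha_hat R b l mu nu xi tau).
Proof.
move=> i j /tau_mono ij; rewrite /alpha_hat /alpha_tilde /chi.
rewrite geq_max; apply/andP; split.
  by apply: leq_trans (leq_maxl _ _); apply: mu_mono; rewrite leq_mul2l leq_add2r ij orbT.
apply: leq_trans (leq_maxr _ _); apply: nu_mono.
have ij2 : (2 * b * (2 * tau i + 1 + 1) <= 2 * b * (2 * tau j + 1 + 1))%N.
  by rewrite leq_mul2l !leq_add2r leq_mul2l ij !orbT.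
rewrite leq_add//; last by apply: ceil_ln_mono => //; rewrite !muln_gt0 b_gt0 addn1.
by rewrite !leq_add2r; exact: xi_mono.
Qed.

(** The iterates serve as test points for the approximate projection [x] of [u0]: from
    [alpha_hat (3 m + 2)] on they lie in [approx_fix (3 m + 2)], hence in [approx_fix m]. *)
Lemma halpern_psi k (g : nat -> nat) :
  exists2 n, (n <= psi R b l mu nu xi tau k g)%N & exists2 x, AF (g n) x &
    forall i, (n <= i)%N -> dot (u0 - x) (u i - x) <= k.+1%:R^-1.
Proof.
set ah := alpha_hat R b l mu nu xi tau.
(* Common approximate fixed points of every quality are found among the iterates. *)
have AFne n : approx_fix (C := C) (l := l) (T := T) n !=set0.
  by exists (u (ah n)); exact: halpern_alpha_hat.
(* The index to be returned is [ah (3 m + 2)], so [g] is composed with this map beforehand. *)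
have [m mle [x Fx xmin]] := approx_proj hX Cconvex b_gt0 diamC Tne
  u0 k (fun m => g (ah (3 * m + 2)%N)) Cu0 AFne.
exists (ah (3 * m + 2)%N).
  by apply: alpha_hat_mono; rewrite /beta leq_add2r leq_mul2l.
exists x => // i hi; apply: xmin.
by apply: approx_fix_le (halpern_alpha_hat _ _ hi); lia.
Qed.

End Rates.

(** [sqr_normD_le] splits off the pull towards [u0], and [(1 - lambda n.+1)^2 <= 1 - lambda n.+1].
    As [x] is only nearly fixed, [U n.+1 (u n)] may be farther from [x] than [u n] by [e]; on
    squares this costs at most [2 b e], since both distances are at most [b]. *)
Lemma halpern_sqr_step n x (e : R) :
  C x -> (forall i, (i < l)%N -> `|x - T i x| <= e) ->
  `|u n.+1 - x| ^+ 2 <=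
    (1 - lambda n.+1) * `|u n - x| ^+ 2
    + lambda n.+1 * (2 * dot (u0 - x) (u n.+1 - x)) + 2 * b%:R * e.
Proof.
move=> Cx xe; have /andP[la0 la1] := lambda01 n.+1.
have {}xe : `|x - U n.+1 x| <= e by apply: xe; rewrite ltn_mod.
have decomp : u n.+1 - x =
    (1 - lambda n.+1) *: (U n.+1 (u n) - x) + lambda n.+1 *: (u0 - x).
  by rewrite halpernS !scalerBr addrACA -opprD -scalerDl subrK scale1r.
have := sqr_normD_le hX ((1 - lambda n.+1) *: (U n.+1 (u n) - x))
  (lambda n.+1 *: (u0 - x)).
rewrite -decomp (linearZl_LR dot)/= sqr_normZ.
have Ux : `|U n.+1 (u n) - x| <= `|u n - x| + e.
  rewrite -(subrKA (U n.+1 x)); apply: le_trans (ler_normD _ _) _.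
  by rewrite lerD 1?[`|U _ x - x|]distrC//; apply: cyclic_ne => //; exact: halpern_in.
have Ub : `|U n.+1 (u n) - x| <= b%:R.
  by apply: diamC => //; apply/cyclic_self/halpern_in.
have ub : `|u n - x| <= b%:R by apply: diamC => //; exact: halpern_in.
have e0 : 0 <= e by apply: le_trans xe.
have U2 : `|U n.+1 (u n) - x| ^+ 2 <= `|u n - x| ^+ 2 + 2 * b%:R * e.
  have : (`|U n.+1 (u n) - x| - `|u n - x|) * (`|U n.+1 (u n) - x| + `|u n - x|)
      <= e * (2 * b%:R).
    apply: le_trans (_ : e * (`|U n.+1 (u n) - x| + `|u n - x|) <= _).
      by rewrite ler_wpM2r ?addr_ge0//; lra.
    by rewrite ler_wpM2l//; lra.
  by rewrite -subr_sqr; lra.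
have la2 : (1 - lambda n.+1) ^+ 2 * `|U n.+1 (u n) - x| ^+ 2
    <= (1 - lambda n.+1) * `|U n.+1 (u n) - x| ^+ 2.
  by rewrite ler_wpM2r ?sqr_ge0//; nra.
have lU2 : (1 - lambda n.+1) * `|U n.+1 (u n) - x| ^+ 2
    <= (1 - lambda n.+1) * (`|u n - x| ^+ 2 + 2 * b%:R * e).
  by rewrite ler_wpM2l// subr_ge0 ltW.
have : 0 <= lambda n.+1 * (b%:R * e) by rewrite !mulr_ge0// ltW.
lra.
Qed.

End Halpern.

(** * Metastability of the iteration *)

Theorem theorem6p10 (R : realType) (X : completeNormedModType R)
    (dot : {dot X for (idfun : R -> R)}) (hX : induces_norm dot)
    (l : nat) (hl : (1 <= l)%N)
    (C : set X) (hC0 : C !=set0) (hCclosed : closed C)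
    (hCconvex : convex_set C) (hCbounded : bounded_set C)
    (b : nat) (hb : (1 <= b)%N)
    (hdiam : forall x y : X, C x -> C y -> `|x - y| <= b%:R)
    (T : nat -> X -> X)
    (hTself : forall i, (i < l)%N -> set_fun C C (T i))
    (hTne : forall i, (i < l)%N -> nonexpansive_on C (T i))
    (tau : nat -> nat) (htau_mono : monotone_nat tau)
    (htau : forall (k m : nat) (x : X), C x ->
       `|x - comp_from (cyclic_maps l T) m l x| <= ((tau k).+1%:R)^-1 ->
       forall i, (i < l)%N -> `|x - cyclic_maps l T i x| < (k.+1%:R)^-1)
    (lambda : nat -> R) (hlambda : forall n, 0 < lambda n < 1)
    (mu nu xi : nat -> nat)
    (hmu_mono : monotone_nat mu) (hnu_mono : monotone_nat nu) (hxi_mono : monotone_nat xi)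
    (hmu : forall k n : nat, (mu k <= n)%N -> lambda n <= (k.+1%:R)^-1)
    (hnu : forall k : nat, \sum_(0 <= j < (nu k).+1) lambda j >= k%:R)
    (hxi : forall k n : nat, (1 <= n)%N ->
       \sum_((xi k).+1 <= j < (xi k + n).+1) `|lambda j - lambda (j + l)%N|
         <= (k.+1%:R)^-1)
    (u0 : X) (hu0 : C u0) (k : nat) (f : nat -> nat) (hf : monotone_nat f) :
  let u := halpern lambda (cyclic_maps l T) u0 in
  exists N : nat, (N <= phi R b l mu nu xi tau k f)%N /\
    forall i j : nat, (N <= i <= f N)%N -> (N <= j <= f N)%N ->
      `|u i - u j| <= (k.+1%:R)^-1.
Proof.
move=> u.
(* The first argument bounds the inner product by [1 / (48 (k + 1)^2)]; [f_bar] makes [x] so nearly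
   fixed that the errors of all steps up to [f N] sum to at most [1 / (18 (k + 1)^2)]. *)
have [n nle [x [Cx xfix] xvi]] := halpern_psi hX hl hCconvex hb hdiam hTself hTne
  hlambda hu0 hmu_mono hnu_mono hxi_mono htau_mono hmu hnu hxi htau
  (48 * (k + 1) ^ 2 - 1) (f_bar R b mu nu k f).
set s' := sigma' R b mu nu (2 * k + 1).
exists (s' n); split.
  rewrite /phi -/s' /s' /sigma'; apply: hnu_mono.
  rewrite leq_add2r leq_add2r geq_max leq_maxr andbT.
  exact: leq_trans nle (leq_maxl _ _).
set F := f (s' n).
set K : R := k.+1%:R.
have K1 : 1 <= K by rewrite ler1n.
have K2 : 0 < K ^+ 2 by rewrite exprn_gt0//; lra.
have B1 : 1 <= b%:R :> R by rewrite ler1n.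
have F0 : 0 < F.+1%:R :> R by rewrite ltr0n.
set e : R := (f_bar R b mu nu k f n).+1%:R^-1 in xfix.
have eE : e = (36 * b%:R * K ^+ 2 * F.+1%:R)^-1.
  rewrite /e /f_bar -/s' -/F subn1 prednK ?addn1; last by rewrite !muln_gt0 hb.
  by rewrite !natrM expr2.
set d : R := (48 * K ^+ 2)^-1.
have dE : (48 * (k + 1) ^ 2 - 1).+1%:R^-1 = d.
  by rewrite subn1 prednK ?addn1 ?muln_gt0// natrM natrX.
rewrite dE in xvi.
(* The variational inequality holds from [M >= n] on, and [s' n] is late enough for the product
   starting after [M] to be at most [1 / (12 b^2 (k + 1)^2)]. *)
set M := maxn n (mu (6 * b ^ 2 * (2 * k + 1 + 1) ^ 2)%N).
(* Closeness of all these iterates to the single point [x] suffices, by the triangle inequality. *)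
have close i : (s' n <= i <= F)%N -> `|u i - x| <= (2 * K)^-1.
  move=> /andP[si iF].
  have K30 : (0 < 3 * b ^ 2 * (2 * k + 1 + 1) ^ 2)%N.
    by rewrite !muln_gt0 hb addn1.
  have [Mi prod_le] := prod_oneminus_rate lambda nu (M + 1) i _
    hlambda hnu K30 si.
  have {}Mi : (M <= i)%N by lia.
  have e0 : 0 <= e by rewrite invr_ge0.
  have d0 : 0 <= d by rewrite invr_ge0; lra.
  rewrite -(@ler_pXn2r _ 2) ?nnegrE ?normr_ge0 ?invr_ge0 ?mulr_ge0//.
  apply: le_trans (affine_rec_le lambda (fun n => `|u n - x| ^+ 2)
    (fun=> 2 * b%:R * e) (2 * d) (b%:R ^+ 2) M hlambda _ _ _ _ i Mi) _.
  - by rewrite mulr_ge0.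
  - by move=> _; rewrite !mulr_ge0.
  - by rewrite lerXn2r ?nnegrE// hdiam//; exact: halpern_in.
  - move=> m Mm; apply: le_trans (halpern_sqr_step hX hl hCconvex hdiam hTself
      hTne hlambda hu0 m x e Cx xfix) _.
    rewrite lerD2r lerD2l ler_wpM2l//; first by have /andP[/ltW] := hlambda m.+1.
    rewrite ler_pM2l//; apply: xvi; apply: leq_trans (leqW Mm).
    by rewrite leq_max leqnn.
  have Kn0 : K ^+ 2 != 0 by rewrite gt_eqF.
  have bn0 : b%:R ^+ 2 != 0 :> R by rewrite gt_eqF// exprn_gt0//; lra.
  have p1 : \prod_(M.+1 <= j < i.+1) (1 - lambda j) * b%:R ^+ 2 <= 12^-1 / K ^+ 2.
    rewrite -ler_pdivlMr ?exprn_gt0//; last lra.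
    move: prod_le; rewrite addn1 => /le_trans; apply.
    rewrite (_ : (2 * k + 1 + 1)%N = (2 * k.+1)%N); last by lia.
    rewrite natrM natrM natrX natrX natrM exprMn -/K.
    move: (K ^+ 2) (b%:R ^+ 2) Kn0 bn0 => P Q P0 Q0.
    by rewrite le_eqVlt; apply/orP; left; apply/eqP; field; rewrite P0 Q0.
  have p2 : \sum_(M.+1 <= j < i.+1) 2 * b%:R * e <= 18^-1 / K ^+ 2.
    rewrite sumr_const_nat -(mulr_natl _ (i.+1 - M.+1)%N).
    (* Here the upper end [i <= F] enters: at most [F + 1] errors have accumulated. *)
    apply: le_trans (_ : F.+1%:R * (2 * b%:R * e) <= _).
      by rewrite ler_wpM2r ?mulr_ge0// ler_nat; lia.
    have b1 : b%:R != 0 :> R by rewrite gt_eqF//; lra.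
    have F1 : F.+1%:R != 0 :> R by rewrite gt_eqF.
    rewrite eE; move: (K ^+ 2) b%:R F.+1%:R Kn0 b1 F1 => P Q G P0 Q0 G0.
    by rewrite le_eqVlt; apply/orP; left; apply/eqP; field; rewrite P0 Q0 G0.
  have K2V : 0 < (K ^+ 2)^-1 by rewrite invr_gt0.
  have -> : (2 * K)^-1 ^+ 2 = 4^-1 / K ^+ 2 by rewrite exprVn exprMn invfM -natrX.
  (* 1/12 + 2/48 + 1/18 <= 1/4 *)
  rewrite {1}/d invfM; move: K2V p1 p2; move: ((K ^+ 2)^-1) => V; lra.
move=> i j /close ui /close uj.
rewrite -(subrKA x); apply: le_trans (ler_normD _ _) _.
rewrite (distrC x); apply: le_trans (lerD ui uj) _.
rewrite -/K le_eqVlt; apply/orP; left; apply/eqP; field.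
by rewrite gt_eqF//; lra.
Qed.
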